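(* Let $(M,g,S)$ be a four-dimensional Riemannian manifold with a skew-circulant structure $S$ (as defined in the context) whose curvature tensor satisfies $R(Sx,Sy,Sz,Su)=R(x,y,z,u)$ for all $x,y,z,u$. Let $p\in M$. If vectors $x,u\in T_pM$ induce $S$-bases of $T_pM$ and $\{S^{3}x,S^{2}x,Sx,x\}$ is an orthonormal basis, then $$\begin{aligned}2(1-\cos^{2}\varphi)\,k(u,Su)+k(u,S^{2}u)={}&k(x,S^{2}x)+2(1-\cos^{2}\varphi)\,k(x,Sx)\\&+\cos^{2}\varphi\,\big(4R(x,Sx,Sx,S^{2}x)+6R(x,Sx,S^{2}x,S^{3}x)\big)\\&+4\cos\varphi\,\big(R(x,Sx,x,S^{2}x)+R(x,Sx,Sx,S^{3}x)\big),\end{aligned}$$ where $\varphi=\angle(u,Su)$.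
   Context: Throughout, $(M,g,S)$ denotes a $4$-dimensional differentiable manifold $M$ with a Riemannian metric $g$ and a tensor $S$ of type $(1,1)$ whose components with respect to the local basis $\{e_1,e_2,e_3,e_4\}$ form the right skew-circulant matrix $$(S_i^j)=\begin{pmatrix}0&1&0&0\\ 0&0&1&0\\ 0&0&0&1\\ -1&0&0&0\end{pmatrix},\qquad Se_i=S_i^j e_j,$$ so $S^4=-\mathrm{id}$. $S$ is assumed to be an isometry: $g(Sx,Sy)=g(x,y)$. Consequently the components $g_{ij}=g(e_i,e_j)$ are $$(g_{ij})=\begin{pmatrix} A & B & 0 & -B \\ B & A & B & 0 \\ 0 & B & A & B \\ -B & 0 & B & A \end{pmatrix}$$ with smooth functions $A,B$, where it is supposed that $A>\sqrt2\,B>0$ (so $g$ is positive definite). Here $x,y,z,u$ are arbitrary smooth vector fields on $M$ or vectors in a tangent space $T_pM$. $\nabla$ is the Levi-Civita connection of $g$, $R(x,y)z=\nabla_x\nabla_y z-\nabla_y\nabla_x z-\nabla_{[x,y]}z$, and $R(x,y,z,u)=g(R(x,y)z,u)$. For linearly independent $x,y\in T_pM$ the sectional curvature of the $2$-plane $\{x,y\}$ is, with the sign convention used here, $$k(x,y)=\frac{R(x,y,x,y)}{g(x,x)g(y,y)-g^2(x,y)}.$$ A vector $x\in T_pM$ induces an $S$-basis of $T_pM$ if $\{S^3x,S^2x,Sx,x\}$ is a basis of $T_pM$. Angles and orthonormality are with respect to $g$. *)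

(* Defs.v *)
From HB Require Import structures.
From mathcomp Require Import all_boot all_order all_algebra.
From mathcomp Require Import all_classical all_reals all_analysis.
Set Implicit Arguments.
Unset Strict Implicit.
Unset Printing Implicit Defensive.
Import Order.TTheory GRing.Theory Num.Theory.
Import numFieldNormedType.Exports.
Local Open Scope classical_set_scope.
Local Open Scope ring_scope.

Section Euclidean.
Variables (R : realType) (n : nat).

(* [pderiv [:: i1; ..; ik] f] is d_i1 (.. (d_ik f)). *)
Definition pderiv (s : seq 'I_n) (f : 'rV[R]_n -> R) : 'rV[R]_n -> R :=
  foldr (fun i h => fun x => 'D_(delta_mx 0 i) h x) f s.

(* C^oo on V (meaningful for V open): all iterated partial derivatives exist
   and are continuous at every point of V. *)
Definition smooth_in (V : set 'rV[R]_n) (f : 'rV[R]_n -> R) : Prop :=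
  forall (s : seq 'I_n) x, V x ->
    {for x, continuous (pderiv s f)} /\
    forall i, derivable (pderiv s f) x (delta_mx 0 i).

End Euclidean.

(* The maps [chart_to] and [chart_from] are total; their values outside
   [chart_dom] and [chart_img] are irrelevant. *)
Record chart (R : realType) (n : nat) (M : topologicalType) := Chart {
  chart_dom : set M;
  chart_img : set 'rV[R]_n;
  chart_to : M -> 'rV[R]_n;
  chart_from : 'rV[R]_n -> M;
  dom_open : open chart_dom;
  img_open : open chart_img;
  to_img : forall q, chart_dom q -> chart_img (chart_to q);
  from_dom : forall x, chart_img x -> chart_dom (chart_from x);
  toK : forall q, chart_dom q -> chart_from (chart_to q) = q;
  fromK : forall x, chart_img x -> chart_to (chart_from x) = x;
  to_continuous : forall q, chart_dom q -> {for q, continuous chart_to};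
  from_continuous : forall x, chart_img x -> {for x, continuous chart_from}
}.

Record manifold (R : realType) (n : nat) := Manifold {
  carrier :> topologicalType;
  manifold_hausdorff : hausdorff_space carrier;
  manifold_second_countable : @second_countable carrier;
  atlas : set (chart R n carrier);
  atlas_cover : forall q : carrier, exists2 c, atlas c & chart_dom c q;
  atlas_compatible : forall c c', atlas c -> atlas c' ->
    forall i, smooth_in (chart_img c `&` chart_from c @^-1` chart_dom c')
                        (fun x => chart_to c' (chart_from c x) 0 i)
}.

Section Tangent.
Variables (R : realType) (n : nat) (M : manifold R n).

Definition smooth_on (U : set M) (f : M -> R) : Prop :=
  forall c : chart R n M, atlas c ->
    smooth_in (chart_img c `&` chart_from c @^-1` U) (f \o chart_from c).

Definition smooth_at (p : M) (f : M -> R) : Prop :=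
  exists2 U : set M, open_nbhs p U & smooth_on U f.

(* Derivations at p of the algebra of germs at p of smooth functions.  Since
   the functional v is defined on all functions M -> R, it is normalised to be
   0 on those that are not smooth near p; this makes equality of functionals
   coincide with equality of derivations. *)
Definition derivation_at (p : M) (v : (M -> R) -> R^o) : Prop :=
  [/\ forall a f h, smooth_at p f -> smooth_at p h ->
        v (fun q => a * f q + h q) = a * v f + v h,
      forall f h, smooth_at p f -> smooth_at p h ->
        v (fun q => f q * h q) = v f * h p + f p * v h,
      forall f h, smooth_at p f -> smooth_at p h ->
        (\forall q \near p, f q = h q) -> v f = v h
    & forall f, ~ smooth_at p f -> v f = 0].

Definition derivations (p : M) : {pred (M -> R) -> R^o} :=
  fun v => `[< derivation_at p v >].

Lemma derivations_submod_closed (p : M) : submod_closed (derivations p).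
Proof.
split=> [|a v w /asboolP[vL vM vG v0] /asboolP[wL wM wG w0]].
  apply/asboolP; split=> //.
  - by move=> a f h _ _; rewrite mulr0 addr0.
  - by move=> f h _ _; rewrite mul0r mulr0 addr0.
have E f : (a *: v + w) f = a * v f + w f by [].
apply/asboolP; split.
- move=> b f h sf sh; rewrite !E vL// wL// !mulrDr !mulrA (mulrC a b).
  by rewrite addrACA.
- move=> f h sf sh; rewrite !E vM// wM// !mulrDl !mulrDr !mulrA.
  by rewrite (mulrC a (f p)) addrACA.
- by move=> f h sf sh fh; rewrite !E (vG _ _ sf sh fh) (wG _ _ sf sh fh).
- by move=> f sf; rewrite E v0// w0// mulr0 addr0.
Qed.

HB.instance Definition _ (p : M) :=
  GRing.isSubmodClosed.Build R ((M -> R) -> R^o) (derivations p)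
    (derivations_submod_closed p).

Record tangent (p : M) := Tangent {
  tangent_val :> (M -> R) -> R^o;
  tangentP : tangent_val \in derivations p
}.

HB.instance Definition _ (p : M) := [isSub for @tangent_val p].
HB.instance Definition _ (p : M) := [Choice of tangent p by <:].
HB.instance Definition _ (p : M) := [SubChoice_isSubLmodule of tangent p by <:].

(* Not necessarily smooth sections of TM; a vector field on an open set U is
   a section that is smooth on U, its values outside U being irrelevant. *)
Definition vfield := forall q : M, tangent q.

Definition vapply (X : vfield) (f : M -> R) : M -> R := fun q => X q f.

Definition vsmooth_on (U : set M) (X : vfield) : Prop :=
  forall (V : set M) f, open V -> V `<=` U -> smooth_on V f ->
    smooth_on V (vapply X f).

(* [X, Y]_p f = X_p (Y f) - Y_p (X f).  This is a derivation at p when X and Y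
   are smooth near p; [insubd] returns 0 where it is not. *)
Definition lie_bracket (X Y : vfield) : vfield := fun p =>
  insubd (0 : tangent p)
    (fun f => if `[< smooth_at p f >]
              then X p (vapply Y f) - Y p (vapply X f) else 0).

Record riemannian_metric := Metric {
  metric_val :> forall p : M, tangent p -> tangent p -> R;
  metric_sym : forall p (x y : tangent p), metric_val x y = metric_val y x;
  metric_linear : forall p a (x y z : tangent p),
    metric_val (a *: x + y) z = a * metric_val x z + metric_val y z;
  metric_pos : forall p (x : tangent p), x != 0 -> 0 < metric_val x x;
  metric_smooth : forall U X Y, open U -> vsmooth_on U X -> vsmooth_on U Y ->
    smooth_on U (fun q => metric_val (X q) (Y q))
}.

(* nabla_X Y is only constrained where X and Y are smooth.  The clauses are
   stated over every open U because vector fields on U need not extend to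
   smooth vector fields on M. *)
Record levi_civita (g : riemannian_metric)
    (nabla : vfield -> vfield -> vfield) : Prop :=
  LeviCivita {
  nabla_smooth : forall U X Y, open U -> vsmooth_on U X -> vsmooth_on U Y ->
    vsmooth_on U (nabla X Y);
  nabla_local : forall U X X' Y Y', open U ->
    vsmooth_on U X -> vsmooth_on U X' -> vsmooth_on U Y -> vsmooth_on U Y' ->
    (forall q, U q -> X q = X' q /\ Y q = Y' q) ->
    forall q, U q -> nabla X Y q = nabla X' Y' q;
  nabla_linear : forall U f X X' Y, open U -> smooth_on U f ->
    vsmooth_on U X -> vsmooth_on U X' -> vsmooth_on U Y ->
    forall q, U q ->
      nabla (fun r => f r *: X r + X' r) Y q = f q *: nabla X Y q + nabla X' Y q;
  nabla_additive : forall U X Y Y', open U ->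
    vsmooth_on U X -> vsmooth_on U Y -> vsmooth_on U Y' ->
    forall q, U q ->
      nabla X (fun r => Y r + Y' r) q = nabla X Y q + nabla X Y' q;
  nabla_leibniz : forall U f X Y, open U -> smooth_on U f ->
    vsmooth_on U X -> vsmooth_on U Y ->
    forall q, U q ->
      nabla X (fun r => f r *: Y r) q = vapply X f q *: Y q + f q *: nabla X Y q;
  nabla_torsion_free : forall U X Y, open U ->
    vsmooth_on U X -> vsmooth_on U Y ->
    forall q, U q -> nabla X Y q - nabla Y X q = lie_bracket X Y q;
  nabla_metric : forall U X Y Z, open U ->
    vsmooth_on U X -> vsmooth_on U Y -> vsmooth_on U Z ->
    forall q, U q ->
      vapply X (fun r => g r (Y r) (Z r)) q
        = g q (nabla X Y q) (Z q) + g q (Y q) (nabla X Z q)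
}.

Definition curvature_op (nabla : vfield -> vfield -> vfield) (X Y Z : vfield) :
    vfield := fun q =>
  nabla X (nabla Y Z) q - nabla Y (nabla X Z) q - nabla (lie_bracket X Y) Z q.

Definition extension (p : M) (v : tangent p) : vfield :=
  xget (fun q => 0 : tangent q)
    [set X : vfield | X p = v /\ exists2 U, open_nbhs p U & vsmooth_on U X].

(* R(x,y)z for x, y, z in T_pM: by tensoriality the value does not depend on
   the local smooth fields extending x, y, z. *)
Definition curvature (nabla : vfield -> vfield -> vfield) (p : M)
    (x y z : tangent p) : tangent p :=
  curvature_op nabla (extension x) (extension y) (extension z) p.

Definition curvature4 (g : riemannian_metric)
    (nabla : vfield -> vfield -> vfield) (p : M) (x y z u : tangent p) : R :=
  g p (curvature nabla x y z) u.

(* The numerator is R(x,y,x,y), not the more common R(x,y,y,x). *)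
Definition sectional (g : riemannian_metric)
    (nabla : vfield -> vfield -> vfield) (p : M) (x y : tangent p) : R :=
  curvature4 g nabla x y x y / (g p x x * g p y y - g p x y ^+ 2).

Definition angle (g : riemannian_metric) (p : M) (x y : tangent p) : R :=
  acos (g p x y / (Num.sqrt (g p x x) * Num.sqrt (g p y y))).

Definition is_basis (p : M) (m : nat) (b : 'I_m -> tangent p) : Prop :=
  (forall a : 'I_m -> R, \sum_i a i *: b i = 0 -> forall i, a i = 0) /\
  (forall v : tangent p, exists a : 'I_m -> R, v = \sum_i a i *: b i).

Definition orthonormal_family (g : riemannian_metric) (p : M) (m : nat)
    (b : 'I_m -> tangent p) : Prop :=
  forall i j, g p (b i) (b j) = (i == j)%:R.

End Tangent.

Section SkewCirculant.
Variables (R : realType) (M : manifold R 4).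

Definition skew_circ : 'M[R]_4 :=
  \matrix_(i, j) ((i.+1 == j :> nat)%:R
                  - ((i == 3 :> nat) && (j == 0 :> nat))%:R).

(* (e_0, .., e_3) is a smooth frame on U, not necessarily a coordinate one.
   The remaining entries of the Gram matrix g(e_i, e_j) are determined by
   A = g(e_0, e_0), B = g(e_0, e_1) and the fact that S is an isometry. *)
Definition adapted_frame (g : riemannian_metric M)
    (S : forall q : M, {linear tangent q -> tangent q})
    (U : set M) (e : 'I_4 -> vfield M) : Prop :=
  (forall i, vsmooth_on U (e i)) /\
  forall q, U q ->
    [/\ is_basis (fun i => e i q),
        forall i, S q (e i q) = \sum_j skew_circ i j *: e j q
      & let A := g q (e 0 q) (e 0 q) in
        let B := g q (e 0 q) (e 1 q) in
        0 < Num.sqrt 2 * B < A].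

Record skew_circulant_structure (g : riemannian_metric M)
    (S : forall q : M, {linear tangent q -> tangent q}) : Prop :=
  SkewCirculantStructure {
  structure_smooth : forall (U : set M) X, open U -> vsmooth_on U X ->
    vsmooth_on U (fun q => S q (X q));
  structure_frame : forall p : M, exists (U : set M) (e : 'I_4 -> vfield M),
    open_nbhs p U /\ adapted_frame g S U e;
  structure_isometry : forall (q : M) (x y : tangent q),
    g q (S q x) (S q y) = g q x y
}.

(* The family S^3 x, S^2 x, S x, x, in this order. *)
Definition S_family (S : forall q : M, {linear tangent q -> tangent q}) (p : M)
    (x : tangent p) : 'I_4 -> tangent p :=
  fun i => iter (3 - i) (S p) x.

Definition induces_S_basis
    (S : forall q : M, {linear tangent q -> tangent q}) (p : M)
    (x : tangent p) : Prop :=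
  is_basis (S_family S x).

End SkewCirculant.

(* Main.v *)
Require Import Defs.
From mathcomp Require Import all_boot all_order all_algebra.
From mathcomp Require Import all_classical all_reals all_analysis.
From mathcomp Require Import ring lra.
Import Order.TTheory GRing.Theory Num.Theory.
Import numFieldNormedType.Exports.
Local Open Scope classical_set_scope.
Local Open Scope ring_scope.
Set Implicit Arguments.
Unset Strict Implicit.
Unset Printing Implicit Defensive.

(** The tangent space at [p] has the orthonormal basis x, Sx, S^2 x, S^3 x.
Since S^4 = -1, the map that S induces on 2-vectors permutes, without signs,
the four planes x /\ Sx -> Sx /\ S^2x -> S^2x /\ S^3x -> x /\ S^3x and the two
planes x /\ S^2x -> Sx /\ S^3x.  The curvature is a quadratic form on 2-vectors
which is invariant under this permutation, so the 21 coefficients of the form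
take only seven values, and the first Bianchi identity R(x, S^2x, Sx, S^3x) =
2 R(x, Sx, S^2x, S^3x) leaves six.  Expanding

  2 R(u, Su, u, Su) + R(u, S^2u, u, S^2u)

in the coordinates of u turns the claim into a polynomial identity whose
coefficients only involve N = g(u, u) and C = g(u, Su)
([skew_circulant_curvature]).  Dividing by N^2 gives the theorem, because
cos phi = C / N, because g(u, S^2u) = g(S^2u, S^4u) = - g(u, S^2u) vanishes,
and because N^2 - C^2 <> 0 by the strict Cauchy-Schwarz inequality.

What remains is that [curvature4], computed on arbitrarily chosen local
extensions of tangent vectors, is an algebraic curvature tensor
([curvature4_like]).  Tensoriality comes almost for free.  For smooth local
fields, g(R(X,Y)Z, W) depends on W only through its value at the point, and it
has the skew symmetries and the Bianchi identity, hence also the symmetry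
under exchange of pairs; these symmetries carry the linearity in W to the
other three slots.  Besides the axioms of the connection, the analysis consists
of three facts: smooth functions form an algebra, the Lie bracket of smooth
fields acts by XY - YX, and it satisfies the Jacobi identity. *)

(** * Smooth functions on an open subset of a coordinate space *)

Section SmoothFunctions.
Variables (R : realType) (n : nat).
Implicit Types (V : set 'rV[R]_n) (f h : 'rV[R]_n -> R).

(** Coinduction for smoothness: a class of once differentiable functions that
is stable under partial derivatives, up to equality on the open set, consists
of smooth functions.  This avoids any Leibniz formula for iterated
derivatives. *)
Lemma smooth_in_coind V (P : ('rV[R]_n -> R) -> Prop) : open V ->
  (forall f, P f -> forall x, V x ->
     {for x, continuous f} /\ forall i, derivable f x (delta_mx 0 i)) ->
  (forall f, P f -> forall i, exists2 f', P f' &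
     forall x, V x -> 'D_(delta_mx 0 i) f x = f' x) ->
  forall f, P f -> smooth_in V f.
Proof.
move=> oV Preg Pder f Pf.
have nearV x h h' : V x -> (forall y, V y -> h y = h' y) ->
    \forall y \near x, h y = h' y :> R.
  move=> Vx hh'; near=> y; apply: hh'; near: y; exact: open_nbhs_nbhs.
have rep s : exists2 f', P f' & forall x, V x -> pderiv s f x = f' x.
  elim: s => [|i s [f' Pf' ff']]; first by exists f.
  have [f'' Pf'' ff''] := Pder _ Pf' i.
  exists f'' => // x Vx; rewrite -ff''//=.
  apply: near_eq_derive; exact: nearV.
move=> s x Vx; have [f' Pf' ff'] := rep s.
have [cf' df'] := Preg _ Pf' _ Vx.
have near_ff' : \forall y \near x, f' y = pderiv s f y.
  by apply: nearV Vx _ => y Vy; rewrite ff'.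
split=> [|i]; last exact: near_eq_derivable (df' i).
change (pderiv s f @ x --> pderiv s f x); rewrite ff'//.
exact: cvg_trans (@near_eq_cvg _ _ (nbhs x) _ _ _ near_ff') cf'.
Unshelve. all: by end_near. Qed.

Lemma smooth_in_regular V f : smooth_in V f -> forall x, V x ->
  {for x, continuous f} /\ forall i, derivable f x (delta_mx 0 i).
Proof. by move=> sf x; exact: (sf [::]). Qed.

Lemma smooth_in_derive V f i : smooth_in V f ->
  smooth_in V (fun x => 'D_(delta_mx 0 i) f x).
Proof.
move=> sf s x Vx; have := sf (rcons s i) x Vx.
by rewrite /pderiv foldr_rcons.
Qed.

Lemma eq_smooth_in V f h : open V -> (forall x, V x -> f x = h x) ->
  smooth_in V f -> smooth_in V h.
Proof.
move=> oV fh sf.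
pose P k := exists2 f', smooth_in V f' & forall x, V x -> f' x = k x.
apply: (@smooth_in_coind V P) => //; last by exists f.
- move=> k [f' sf' fk] x Vx; have [cf' df'] := smooth_in_regular sf' Vx.
  have near_fk : \forall y \near x, f' y = k y.
    by near=> y; apply: fk; near: y; exact: open_nbhs_nbhs.
  split=> [|i]; last exact: near_eq_derivable (df' i).
  change (k @ x --> k x); rewrite -fk//.
  exact: cvg_trans (@near_eq_cvg _ _ (nbhs x) _ _ _ near_fk) cf'.
- move=> k [f' sf' fk] i; exists (fun x => 'D_(delta_mx 0 i) f' x).
    by exists (fun x => 'D_(delta_mx 0 i) f' x) => //; exact: smooth_in_derive.
  move=> x Vx; apply: near_eq_derive.
  by near=> y; apply/esym/fk; near: y; exact: open_nbhs_nbhs.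
Unshelve. all: by end_near. Qed.

Lemma smooth_in_sub V W f : W `<=` V -> smooth_in V f -> smooth_in W f.
Proof. by move=> WV sf s x /WV; exact: sf. Qed.

Lemma smooth_in_cst V (a : R) : open V -> smooth_in V (fun=> a).
Proof.
move=> oV; apply: (@smooth_in_coind V (fun f => exists b, f = cst b)) => //.
- move=> _ [b ->] x _; split=> [|i]; first exact: cst_continuous.
  exact: derivable_cst.
- move=> _ [b ->] i; exists (cst 0); first by exists 0.
  by move=> x _; rewrite derive_cst.
- by exists a.
Qed.

(** The derivative of a product is a sum of products, so the class of products
of smooth functions is not stable under derivatives but the algebra that they
generate is. *)
Inductive smooth_algebra V : ('rV[R]_n -> R) -> Prop :=
| SmoothGen f : smooth_in V f -> smooth_algebra V f
| SmoothAdd f h : smooth_algebra V f -> smooth_algebra V h ->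
    smooth_algebra V (f + h)
| SmoothMul f h : smooth_algebra V f -> smooth_algebra V h ->
    smooth_algebra V (f * h).

Lemma smooth_algebra_smooth V f : open V -> smooth_algebra V f ->
  smooth_in V f.
Proof.
move=> oV.
have reg k : smooth_algebra V k -> forall x, V x ->
    {for x, continuous k} /\ forall i, derivable k x (delta_mx 0 i).
  elim=> {k} [k sk|k l _ IHk _ IHl|k l _ IHk _ IHl] x Vx.
  - exact: smooth_in_regular sk _ Vx.
  - have [[ck dk] [cl dl]] := (IHk x Vx, IHl x Vx).
    by split=> [|i]; [exact: (continuousD ck cl) | exact: derivableD].
  - have [[ck dk] [cl dl]] := (IHk x Vx, IHl x Vx).
    by split=> [|i]; [exact: (continuousM ck cl) | exact: derivableM].
apply: smooth_in_coind => // k ak i.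
elim: ak => {k} [k sk|k l ak [k' ak' kk'] al [l' al' ll']
                     |k l ak [k' ak' kk'] al [l' al' ll']].
- exists (fun x => 'D_(delta_mx 0 i) k x) => //.
  exact/SmoothGen/smooth_in_derive.
- exists (k' + l'); first exact: SmoothAdd.
  move=> x Vx; have [[_ dk] [_ dl]] := (reg _ ak x Vx, reg _ al x Vx).
  by rewrite deriveD// kk'// ll'.
- exists (k * l' + l * k'); first by apply: SmoothAdd; exact: SmoothMul.
  move=> x Vx; have [[_ dk] [_ dl]] := (reg _ ak x Vx, reg _ al x Vx).
  by rewrite deriveM// kk'// ll'.
Qed.

Lemma smooth_inD V f h : open V -> smooth_in V f -> smooth_in V h ->
  smooth_in V (fun x => f x + h x).
Proof.
by move=> oV sf sh; apply: smooth_algebra_smooth oV (SmoothAdd _ _);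
  exact: SmoothGen.
Qed.

Lemma smooth_inM V f h : open V -> smooth_in V f -> smooth_in V h ->
  smooth_in V (fun x => f x * h x).
Proof.
by move=> oV sf sh; apply: smooth_algebra_smooth oV (SmoothMul _ _);
  exact: SmoothGen.
Qed.

End SmoothFunctions.

(** * Germs, tangent vectors and the Lie bracket *)

Section Germs.
Variables (R : realType) (n : nat) (M : manifold R n).
Implicit Types (U V : set M) (f h : M -> R) (p q : M) (X Y Z : vfield M).

Lemma chart_preimage_open (c : chart R n M) U : open U ->
  open (chart_img c `&` chart_from c @^-1` U).
Proof.
move=> oU; rewrite openE => x [cx Ux].
near=> y; split; near: y.
- by apply: open_nbhs_nbhs; split=> //; exact: img_open.
- by apply: (from_continuous cx); exact: open_nbhs_nbhs.
Unshelve. all: by end_near. Qed.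

Lemma smooth_on_sub U V f : V `<=` U -> smooth_on U f -> smooth_on V f.
Proof.
move=> VU sf c ac; apply: smooth_in_sub (sf c ac) => x [cx Vx].
by split=> //; exact: VU.
Qed.

Lemma eq_smooth_on U f h : open U -> (forall q, U q -> f q = h q) ->
  smooth_on U f -> smooth_on U h.
Proof.
move=> oU fh sf c ac; apply: eq_smooth_in (sf c ac).
  exact: chart_preimage_open.
by move=> x [_ /fh].
Qed.

Lemma smooth_on_cst U (a : R) : open U -> smooth_on U (fun=> a).
Proof. by move=> oU c _; apply: smooth_in_cst; exact: chart_preimage_open. Qed.

Lemma smooth_onD U f h : open U -> smooth_on U f -> smooth_on U h ->
  smooth_on U (fun q => f q + h q).
Proof.
move=> oU sf sh c ac.
by apply: smooth_inD (sf c ac) (sh c ac); exact: chart_preimage_open.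
Qed.

Lemma smooth_onM U f h : open U -> smooth_on U f -> smooth_on U h ->
  smooth_on U (fun q => f q * h q).
Proof.
move=> oU sf sh c ac.
by apply: smooth_inM (sf c ac) (sh c ac); exact: chart_preimage_open.
Qed.

Lemma smooth_on_lin U a f h : open U -> smooth_on U f -> smooth_on U h ->
  smooth_on U (fun q => a * f q + h q).
Proof.
move=> oU sf sh.
exact: (smooth_onD oU (smooth_onM oU (smooth_on_cst a oU) sf) sh).
Qed.

Lemma smooth_on_at U f p : open U -> U p -> smooth_on U f -> smooth_at p f.
Proof. by move=> oU Up sf; exists U. Qed.

Lemma smooth_at_common p f h : smooth_at p f -> smooth_at p h ->
  exists U, [/\ open U, U p, smooth_on U f & smooth_on U h].
Proof.
move=> [U [oU Up] sf] [V [oV Vp] sh]; exists (U `&` V); split=> //.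
- exact: openI.
- exact: smooth_on_sub (@subIsetl _ U V) sf.
- exact: smooth_on_sub (@subIsetr _ U V) sh.
Qed.

Lemma smooth_at_lin p a f h : smooth_at p f -> smooth_at p h ->
  smooth_at p (fun q => a * f q + h q).
Proof.
move=> sf sh; have [U [oU Up {}sf {}sh]] := smooth_at_common sf sh.
by apply: (smooth_on_at oU Up); exact: smooth_on_lin.
Qed.

Lemma smooth_atM p f h : smooth_at p f -> smooth_at p h ->
  smooth_at p (fun q => f q * h q).
Proof.
move=> sf sh; have [U [oU Up {}sf {}sh]] := smooth_at_common sf sh.
by apply: (smooth_on_at oU Up); exact: smooth_onM.
Qed.

Lemma smooth_at_near p f : smooth_at p f -> \forall q \near p, smooth_at q f.
Proof.
move=> [U [oU Up] sf]; near=> q; apply: (smooth_on_at oU) => //.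
by near: q; exact: open_nbhs_nbhs.
Unshelve. all: by end_near. Qed.

Lemma eq_smooth_at p f h : (\forall q \near p, f q = h q) ->
  smooth_at p f -> smooth_at p h.
Proof.
rewrite /prop_near1 nbhsE => -[V [oV Vp] fh] [U [oU Up] sf].
have oUV : open (U `&` V) by exact: openI.
exists (U `&` V); first by split=> //; split=> //; exact: Vp.
apply: (@eq_smooth_on _ f h) => //; first by move=> q [_ /fh].
exact: smooth_on_sub (@subIsetl _ U V) sf.
Qed.

Lemma tangent_derivation p (v : tangent p) : derivation_at p v.
Proof. by have /asboolP := tangentP v. Qed.

Lemma tangentDE p (v w : tangent p) f : (v + w) f = v f + w f.
Proof. by have /(congr1 (fun k => k f)) := raddfD \val v w. Qed.

Lemma tangentNE p (v : tangent p) f : (- v) f = - v f.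
Proof. by have /(congr1 (fun k => k f)) := raddfN \val v. Qed.

Lemma tangentZE p a (v : tangent p) f : (a *: v) f = a * v f.
Proof. by rewrite -[LHS]/(\val (a *: v) f) GRing.valZ. Qed.

Lemma eq_tangent p (v w : tangent p) :
  (forall f, smooth_at p f -> v f = w f) -> v = w.
Proof.
move=> vw; apply/val_inj/funext => f /=.
have [sf|nsf] := pselect (smooth_at p f); first exact: vw.
have [_ _ _ v0] := tangent_derivation v.
have [_ _ _ w0] := tangent_derivation w.
by rewrite v0// w0.
Qed.

Lemma tangent_lin p (v : tangent p) a f h : smooth_at p f -> smooth_at p h ->
  v (fun q => a * f q + h q) = a * v f + v h.
Proof. by have [+ _ _ _] := tangent_derivation v; apply. Qed.

Lemma tangent_mul p (v : tangent p) f h : smooth_at p f -> smooth_at p h ->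
  v (fun q => f q * h q) = v f * h p + f p * v h.
Proof. by have [_ + _ _] := tangent_derivation v; apply. Qed.

Lemma tangent_germ p (v : tangent p) f h : smooth_at p f ->
  (\forall q \near p, f q = h q) -> v f = v h.
Proof.
move=> sf fh; have [_ _ + _] := tangent_derivation v.
by move=> germ; exact: germ sf (eq_smooth_at fh sf) fh.
Qed.

Lemma tangent_sub p (v : tangent p) f h : smooth_at p f -> smooth_at p h ->
  v (fun q => f q - h q) = v f - v h.
Proof.
move=> sf sh; transitivity (v (fun q => (-1) * h q + f q)).
  by congr (tangent_val v _); apply/funext => q; rewrite mulN1r addrC.
by rewrite (tangent_lin v (-1) sh sf) mulN1r addrC.
Qed.

Lemma vsmooth_on_sub U V X : V `<=` U -> vsmooth_on U X -> vsmooth_on V X.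
Proof. by move=> VU sX W f oW WV; apply: sX => //; exact: subset_trans VU. Qed.

Lemma eq_vsmooth_on U X Y : (forall q, U q -> X q = Y q) ->
  vsmooth_on U X -> vsmooth_on U Y.
Proof.
move=> XY sX V f oV VU sf; apply: eq_smooth_on (sX V f oV VU sf) => // q Vq.
by rewrite /vapply XY//; exact: VU.
Qed.

Lemma vsmooth_on_lin U a X Y : vsmooth_on U X -> vsmooth_on U Y ->
  vsmooth_on U (fun q => a *: X q + Y q).
Proof.
move=> sX sY V f oV VU sf.
apply: (@eq_smooth_on V (fun q => a * vapply X f q + vapply Y f q) _ oV).
  by move=> q _; rewrite /vapply -tangentZE -tangentDE.
exact: smooth_on_lin oV (sX V f oV VU sf) (sY V f oV VU sf).
Qed.

Lemma vsmooth_on0 U : vsmooth_on U (fun=> 0).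
Proof.
by move=> V f oV _ _; exact: smooth_on_cst 0 oV.
Qed.

Lemma vsmooth_onB U X Y : vsmooth_on U X -> vsmooth_on U Y ->
  vsmooth_on U (fun q => X q - Y q).
Proof.
move=> sX sY; have := @vsmooth_on_lin U (-1) _ _ sY sX.
by apply: eq_vsmooth_on => q _; rewrite scaleN1r addrC.
Qed.

Lemma vsmooth_on_sum U m (a : 'I_m -> R) (e : 'I_m -> vfield M) :
  (forall i, vsmooth_on U (e i)) ->
  vsmooth_on U (fun q => \sum_i a i *: e i q).
Proof.
move=> se; elim: m a e se => [|m IH] a e se.
  by apply: (@eq_vsmooth_on U (fun=> 0)) => [q _|];
    [rewrite big_ord0 | exact: vsmooth_on0].
have sm := IH (a \o lift ord0) (e \o lift ord0) (fun=> se _).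
apply: (eq_vsmooth_on _ (vsmooth_on_lin (a ord0) (se ord0) sm)) => q _.
by rewrite big_ord_recl.
Qed.

Lemma vapply_smooth_at U X f p : open U -> U p -> vsmooth_on U X ->
  smooth_at p f -> smooth_at p (vapply X f).
Proof.
move=> oU Up sX [V [oV Vp] sf].
have oUV : open (U `&` V) by exact: openI.
apply: (smooth_on_at oUV) => //.
exact: sX _ _ oUV (@subIsetl _ U V) (smooth_on_sub (@subIsetr _ U V) sf).
Qed.

(** Terms such as Xf * Yh + Yf * Xh, which prevent XY from being a derivation,
cancel in XY - YX.  Identities for Y (f h) hold only at the points where [f]
and [h] are smooth; these form a neighbourhood of [p], which is all that the
tangent vector X at [p] sees. *)
Lemma lie_bracket_derivation U X Y p : open U -> U p -> vsmooth_on U X ->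
  vsmooth_on U Y ->
  derivation_at p (fun f => if `[< smooth_at p f >]
    then X p (vapply Y f) - Y p (vapply X f) else 0).
Proof.
move=> oU Up sX sY.
set D := (D in derivation_at p D).
have DE f : smooth_at p f -> D f = X p (vapply Y f) - Y p (vapply X f).
  by move=> sf; rewrite /D (asboolT sf).
have sXf f := vapply_smooth_at oU Up sX (f := f).
have sYf f := vapply_smooth_at oU Up sY (f := f).
have near_lin Z a f h : smooth_at p f -> smooth_at p h ->
    \forall q \near p, a * vapply Z f q + vapply Z h q
      = vapply Z (fun q => a * f q + h q) q.
  move=> /smooth_at_near sf /smooth_at_near sh.
  apply: filterS2 sf sh => q sfq shq.
  exact: esym (tangent_lin (Z q) a sfq shq).
have near_mul Z f h : smooth_at p f -> smooth_at p h ->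
    \forall q \near p, vapply Z f q * h q + f q * vapply Z h q
      = vapply Z (fun q => f q * h q) q.
  move=> /smooth_at_near sf /smooth_at_near sh.
  apply: filterS2 sf sh => q sfq shq.
  exact: esym (tangent_mul (Z q) sfq shq).
have near_eq Z f h : smooth_at p f -> (\forall q \near p, f q = h q) ->
    \forall q \near p, vapply Z f q = vapply Z h q.
  move=> /smooth_at_near sf /near_join fh.
  apply: filterS2 sf fh => q sfq fhq. exact (tangent_germ (Z q) sfq fhq).
split.
- move=> a f h sf sh; rewrite (DE _ sf) (DE _ sh).
  rewrite (DE _ (smooth_at_lin a sf sh)).
  have sXl := smooth_at_lin a (sXf _ sf) (sXf _ sh).
  have sYl := smooth_at_lin a (sYf _ sf) (sYf _ sh).
  rewrite -(tangent_germ (X p) sYl (near_lin Y a f h sf sh)).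
  rewrite -(tangent_germ (Y p) sXl (near_lin X a f h sf sh)).
  rewrite (tangent_lin (X p) a (sYf _ sf) (sYf _ sh)).
  by rewrite (tangent_lin (Y p) a (sXf _ sf) (sXf _ sh)); ring.
- move=> f h sf sh; rewrite (DE _ sf) (DE _ sh) (DE _ (smooth_atM sf sh)).
  have sm Z : smooth_at p (vapply Z f) -> smooth_at p (vapply Z h) ->
      smooth_at p (fun q => vapply Z f q * h q + f q * vapply Z h q).
    move=> sZf sZh.
    have := smooth_at_lin 1 (smooth_atM sZf sh) (smooth_atM sf sZh).
    by apply: eq_smooth_at; apply: nearW => q; rewrite mul1r.
  have der Z (v : tangent p) : smooth_at p (vapply Z f) ->
      smooth_at p (vapply Z h) ->
      v (vapply Z (fun q => f q * h q)) =
      v (vapply Z f) * h p + Z p f * v h + (v f * Z p h + f p * v (vapply Z h)).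
    move=> sZf sZh.
    rewrite -(tangent_germ v (sm Z sZf sZh) (near_mul Z f h sf sh)).
    transitivity (v (fun q => 1 * (vapply Z f q * h q) + f q * vapply Z h q)).
      by congr (tangent_val v _); apply/funext => q; rewrite mul1r.
    rewrite (tangent_lin v 1 (smooth_atM sZf sh) (smooth_atM sf sZh)) mul1r.
    by rewrite (tangent_mul v sZf sh) (tangent_mul v sf sZh).
  rewrite (der Y (X p) (sYf _ sf) (sYf _ sh)).
  rewrite (der X (Y p) (sXf _ sf) (sXf _ sh)).
  by ring.
- move=> f h sf sh fh; rewrite (DE _ sf) (DE _ sh); congr (_ - _).
    exact (tangent_germ (X p) (sYf _ sf) (near_eq Y f h sf fh)).
  exact (tangent_germ (Y p) (sXf _ sf) (near_eq X f h sf fh)).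
- by move=> f nsf; rewrite /D (asboolF nsf).
Qed.

Lemma lie_bracketE U X Y p f : open U -> U p -> vsmooth_on U X ->
  vsmooth_on U Y -> smooth_at p f ->
  lie_bracket X Y p f = X p (vapply Y f) - Y p (vapply X f).
Proof.
move=> oU Up sX sY sf; rewrite /lie_bracket.
have := insubdK (0 : tangent p)
  (introT (asboolP _) (lie_bracket_derivation oU Up sX sY)).
by move=> /(congr1 (fun k => k f)) /= ->; rewrite (asboolT sf).
Qed.

Lemma lie_bracketC U X Y p : open U -> U p -> vsmooth_on U X ->
  vsmooth_on U Y -> lie_bracket X Y p = - lie_bracket Y X p.
Proof.
move=> oU Up sX sY; apply: eq_tangent => f sf.
rewrite tangentNE (lie_bracketE oU Up sX sY sf) (lie_bracketE oU Up sY sX sf).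
by rewrite opprB.
Qed.

End Germs.

(** * Symmetries of the curvature operator on local smooth fields *)

Section Curvature.
Variables (R : realType) (n : nat) (M : manifold R n).
Variables (g : riemannian_metric M) (nabla : vfield M -> vfield M -> vfield M).
Hypothesis hnabla : levi_civita g nabla.
Implicit Types (U : set M) (X Y Z W : vfield M).

Lemma metricDl q (x y z : tangent q) : g q (x + y) z = g q x z + g q y z.
Proof. by have := metric_linear g 1 x y z; rewrite scale1r mul1r. Qed.

Lemma metric0l q (z : tangent q) : g q 0 z = 0.
Proof. by apply: (addrI (g q 0 z)); rewrite -metricDl !addr0. Qed.

Lemma metricZl q a (x z : tangent q) : g q (a *: x) z = a * g q x z.
Proof. by have := metric_linear g a x 0 z; rewrite addr0 metric0l addr0. Qed.

Lemma metricBl q (x y z : tangent q) : g q (x - y) z = g q x z - g q y z.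
Proof. by rewrite metricDl -scaleN1r metricZl mulN1r. Qed.

Lemma metricDr q (x y z : tangent q) : g q z (x + y) = g q z x + g q z y.
Proof.
by rewrite Defs.metric_sym metricDl (Defs.metric_sym g x) (Defs.metric_sym g y).
Qed.

Lemma metricZr q a (x z : tangent q) : g q z (a *: x) = a * g q z x.
Proof. by rewrite Defs.metric_sym metricZl (Defs.metric_sym g x). Qed.

(** The bracket is the antisymmetrisation of a torsion-free connection, which
preserves smoothness by assumption. *)
Lemma lie_bracket_smooth U X Y : open U -> vsmooth_on U X -> vsmooth_on U Y ->
  vsmooth_on U (lie_bracket X Y).
Proof.
move=> oU sX sY.
have sXY := nabla_smooth hnabla oU sX sY.
have sYX := nabla_smooth hnabla oU sY sX.
apply: (eq_vsmooth_on _ (vsmooth_onB sXY sYX)) => q Uq.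
exact: (nabla_torsion_free hnabla oU sX sY Uq).
Qed.

Lemma nablaNl U X X' Z q : open U -> U q -> vsmooth_on U X ->
  vsmooth_on U X' -> vsmooth_on U Z -> (forall r, U r -> X' r = - X r) ->
  nabla X' Z q = - nabla X Z q.
Proof.
move=> oU Uq sX sX' sZ X'E; have s0 := vsmooth_on0 (M := M) (U := U).
have lin a Y Y' sY sY' :=
  nabla_linear hnabla oU (smooth_on_cst (M := M) a oU) sY sY' sZ Uq
    (X := Y) (X' := Y').
have n0 : nabla (fun=> 0) Z q = 0.
  have := lin (-1) _ _ s0 s0; rewrite scaleN1r addNr => <-.
  by congr (nabla _ Z q); apply: functional_extensionality_dep => r;
    rewrite scaler0 addr0.
have sNX := vsmooth_on_lin (-1) sX s0.
transitivity (nabla (fun r => (-1) *: X r + 0) Z q); last first.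
  by rewrite (lin (-1) _ _ sX s0) n0 addr0 scaleN1r.
apply: (nabla_local hnabla oU sX' sNX sZ sZ) => // r Ur.
by rewrite X'E// scaleN1r addr0.
Qed.

Lemma nablaBr U X Y Y' Z q : open U -> U q -> vsmooth_on U X ->
  vsmooth_on U Y -> vsmooth_on U Y' -> vsmooth_on U Z ->
  (forall r, U r -> Z r = Y r - Y' r) ->
  nabla X Z q = nabla X Y q - nabla X Y' q.
Proof.
move=> oU Uq sX sY sY' sZ ZE; apply/eqP; rewrite eq_sym subr_eq; apply/eqP.
rewrite -(nabla_additive hnabla oU sX sZ sY' Uq).
have sZY' := vsmooth_on_lin 1 sZ sY'.
have sZY : vsmooth_on U (fun r => Z r + Y' r).
  by apply: (eq_vsmooth_on _ sZY') => r _; rewrite scale1r.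
apply: (nabla_local hnabla oU sX sX sY sZY) => // r Ur.
by rewrite (ZE _ Ur) subrK.
Qed.

Lemma tangent_on U q (v : tangent q) f h : open U -> U q -> smooth_on U f ->
  (forall r, U r -> f r = h r) -> v f = v h.
Proof.
move=> oU Uq sf fh; apply: tangent_germ (smooth_on_at oU Uq sf) _.
have : \forall r \near q, U r by exact: open_nbhs_nbhs.
by apply: filterS => r /fh.
Qed.

Lemma lie_bracket_jacobi U X Y Z q : open U -> U q -> vsmooth_on U X ->
  vsmooth_on U Y -> vsmooth_on U Z ->
  lie_bracket X (lie_bracket Y Z) q + lie_bracket Y (lie_bracket Z X) q
    + lie_bracket Z (lie_bracket X Y) q = 0.
Proof.
move=> oU Uq sX sY sZ; apply: eq_tangent => f sf.
have smooth2 (A B : vfield M) : vsmooth_on U A -> vsmooth_on U B ->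
    smooth_at q (vapply A (vapply B f)).
  move=> sA sB; apply: (vapply_smooth_at oU Uq sA).
  exact: (vapply_smooth_at oU Uq sB).
have nested (A B C : vfield M) : vsmooth_on U A -> vsmooth_on U B ->
    vsmooth_on U C -> lie_bracket A (lie_bracket B C) q f =
    A q (vapply B (vapply C f)) - A q (vapply C (vapply B f))
    - (B q (vapply C (vapply A f)) - C q (vapply B (vapply A f))).
  move=> sA sB sC; have sBC := lie_bracket_smooth oU sB sC.
  rewrite (lie_bracketE oU Uq sA sBC sf); congr (_ - _); last first.
    exact: (lie_bracketE oU Uq sB sC (vapply_smooth_at oU Uq sA sf)).
  rewrite -(tangent_sub (A q) (smooth2 B C sB sC) (smooth2 C B sC sB)).
  apply: tangent_germ; first exact: (vapply_smooth_at oU Uq sBC sf).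
  have nU : \forall r \near q, U r by exact: open_nbhs_nbhs.
  apply: filterS2 nU (smooth_at_near sf) => r Ur sfr.
  exact: (lie_bracketE oU Ur sB sC sfr).
rewrite !tangentDE (nested X Y Z sX sY sZ) (nested Y Z X sY sZ sX).
rewrite (nested Z X Y sZ sX sY).
have -> : (0 : tangent q) f = 0.
  by have := tangentZE 0 (0 : tangent q) f; rewrite scale0r mul0r.
by ring.
Qed.

Lemma curvature_op_anti U X Y Z q : open U -> U q -> vsmooth_on U X ->
  vsmooth_on U Y -> vsmooth_on U Z ->
  curvature_op nabla X Y Z q = - curvature_op nabla Y X Z q.
Proof.
move=> oU Uq sX sY sZ; rewrite /curvature_op.
have sXY := lie_bracket_smooth oU sX sY.
have sYX := lie_bracket_smooth oU sY sX.
rewrite (nablaNl oU Uq sXY sYX sZ); last first.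
  by move=> r Ur; exact: (lie_bracketC oU Ur sY sX).
by rewrite opprK opprD opprB.
Qed.

(** Regrouped with torsion-freeness, the cyclic sum of the curvature becomes the
cyclic sum of iterated brackets, which vanishes by the Jacobi identity. *)
Lemma curvature_op_bianchi U X Y Z q : open U -> U q -> vsmooth_on U X ->
  vsmooth_on U Y -> vsmooth_on U Z ->
  curvature_op nabla X Y Z q + curvature_op nabla Y Z X q
    + curvature_op nabla Z X Y q = 0.
Proof.
move=> oU Uq sX sY sZ; rewrite /curvature_op.
have nested (A B C : vfield M) : vsmooth_on U A -> vsmooth_on U B ->
    vsmooth_on U C -> lie_bracket A (lie_bracket B C) q =
    nabla A (nabla B C) q - nabla A (nabla C B) q - nabla (lie_bracket B C) A q.
  move=> sA sB sC; have sBC := lie_bracket_smooth oU sB sC.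
  rewrite -(nabla_torsion_free hnabla oU sA sBC Uq); congr (_ - _).
  apply: (nablaBr oU Uq sA _ _ sBC).
  - exact: (nabla_smooth hnabla oU sB sC).
  - exact: (nabla_smooth hnabla oU sC sB).
  - by move=> r Ur; rewrite (nabla_torsion_free hnabla oU sB sC Ur).
rewrite -[RHS](lie_bracket_jacobi oU Uq sX sY sZ).
rewrite (nested X Y Z sX sY sZ) (nested Y Z X sY sZ sX) (nested Z X Y sZ sX sY).
(* Both sides have the same nine terms; evaluating on a function moves the
   identity to a commutative ring. *)
apply: eq_tangent => f _; rewrite !(tangentDE, tangentNE).
by ring.
Qed.

Lemma metric_second_derivative U X Y Z W q : open U -> U q ->
  vsmooth_on U X -> vsmooth_on U Y -> vsmooth_on U Z -> vsmooth_on U W ->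
  X q (vapply Y (fun r => g r (Z r) (W r))) =
  g q (nabla X (nabla Y Z) q) (W q) + g q (nabla Y Z q) (nabla X W q)
  + (g q (nabla X Z q) (nabla Y W q) + g q (Z q) (nabla X (nabla Y W) q)).
Proof.
move=> oU Uq sX sY sZ sW.
have sYZ := nabla_smooth hnabla oU sY sZ.
have sYW := nabla_smooth hnabla oU sY sW.
have s1 := metric_smooth g oU sYZ sW.
have s2 := metric_smooth g oU sZ sYW.
rewrite -(nabla_metric hnabla oU sX sYZ sW Uq).
rewrite -(nabla_metric hnabla oU sX sZ sYW Uq) /vapply.
rewrite -[X q _ in RHS]mul1r.
rewrite -(tangent_lin (X q) 1 (smooth_on_at oU Uq s1) (smooth_on_at oU Uq s2)).
apply/esym/(tangent_on (X q) oU Uq (smooth_on_lin 1 oU s1 s2)) => r Ur.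
by rewrite mul1r; apply/esym/(nabla_metric hnabla oU sY sZ sW Ur).
Qed.

(** Compare XY - YX with [X, Y] on the function g(Z, W): the mixed terms of the
second derivatives are symmetric in X and Y. *)
Lemma curvature_op_skew U X Y Z W q : open U -> U q ->
  vsmooth_on U X -> vsmooth_on U Y -> vsmooth_on U Z -> vsmooth_on U W ->
  g q (curvature_op nabla X Y Z q) (W q)
    = - g q (curvature_op nabla X Y W q) (Z q).
Proof.
move=> oU Uq sX sY sZ sW; rewrite /curvature_op !metricBl.
have sXY := lie_bracket_smooth oU sX sY.
have sZW : smooth_at q (fun r => g r (Z r) (W r)).
  exact: (smooth_on_at oU Uq (metric_smooth g oU sZ sW)).
have := nabla_metric hnabla oU sXY sZ sW Uq.
rewrite /vapply (lie_bracketE oU Uq sX sY sZW).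
rewrite (metric_second_derivative oU Uq sX sY sZ sW).
rewrite (metric_second_derivative oU Uq sY sX sZ sW).
rewrite !(Defs.metric_sym g (Z q)) (Defs.metric_sym g (nabla X Z q)) => E.
by apply/eqP; rewrite -subr_eq0 opprK; apply/eqP; lra.
Qed.

End Curvature.

(** * Algebraic curvature tensors *)

Section AlgebraicCurvature.
Variables (R : realType) (V : lmodType R).
Implicit Types (T : V -> V -> V -> V -> R) (x y z w u v : V).

(** Linearity is required in the last slot only; the symmetries carry it to the
others. *)
Record curvature_like T : Prop := CurvatureLike {
  curvature_like_linear : forall a x y z w w',
    T x y z (a *: w + w') = a * T x y z w + T x y z w';
  curvature_like_anti : forall x y z w, T x y z w = - T y x z w;
  curvature_like_skew : forall x y z w, T x y z w = - T x y w z;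
  curvature_like_bianchi : forall x y z w,
    T x y z w + T y z x w + T z x y w = 0
}.

(** The octahedron argument: a combination of four Bianchi identities. *)
Lemma curvature_like_pair T : curvature_like T ->
  forall x y z w, T x y z w = T z w x y.
Proof.
move=> [_ anti skew bianchi] x y z w.
have := (bianchi x y z w, bianchi y z w x, bianchi z w x y, bianchi w x y z).
move=> [[[b1 b2] b3] b4].
have := (anti w x y z, anti w y z x, anti w z x y, anti z x y w).
have := (skew x y z w, skew z w x y, skew x z y w, skew y w x z).
have := (skew y z x w, skew x w y z, anti y z w x, anti y w z x).
have := (anti w y x z, skew w x y z, skew z x w y, skew z x y w).
have := (anti y w x z, skew w y x z, skew w z x y, anti z w y x, skew y z w x).
move=> [[[[p1 p2] p3] p4] p5] [[[q1 q2] q3] q4] [[[r1 r2] r3] r4].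
move=> [[[s1 s2] s3] s4] [[[t1 t2] t3] t4].
lra.
Qed.

Lemma curvature_like_linear2 T : curvature_like T -> forall a x y y' z w,
  T x (a *: y + y') z w = a * T x y z w + T x y' z w.
Proof.
move=> hT a x y y' z w; rewrite !(curvature_like_pair hT _ _ z w).
exact: curvature_like_linear.
Qed.

Lemma alternating_expansion (F : V -> V -> R) (e0 e1 e2 e3 : V)
    (a0 a1 a2 a3 b0 b1 b2 b3 : R) :
  (forall a x y z, F x (a *: y + z) = a * F x y + F x z) ->
  (forall x y, F x y = - F y x) ->
  F (a0 *: e0 + (a1 *: e1 + (a2 *: e2 + a3 *: e3)))
    (b0 *: e0 + (b1 *: e1 + (b2 *: e2 + b3 *: e3))) =
  (a0 * b1 - a1 * b0) * F e0 e1 + (a1 * b2 - a2 * b1) * F e1 e2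
  + (a2 * b3 - a3 * b2) * F e2 e3 + (a0 * b3 - a3 * b0) * F e0 e3
  + (a0 * b2 - a2 * b0) * F e0 e2 + (a1 * b3 - a3 * b1) * F e1 e3.
Proof.
move=> linr alt.
have F0 x : F x 0 = 0.
  by have := linr (-1) x 0 0; rewrite scaleN1r addNr => ->; ring.
have Zr a x y : F x (a *: y) = a * F x y.
  by have := linr a x y 0; rewrite !addr0 F0 addr0.
have linl a x y z : F (a *: y + z) x = a * F y x + F z x.
  by rewrite alt linr (alt y) (alt z); ring.
have Zl a x y : F (a *: y) x = a * F y x by rewrite alt Zr (alt y); ring.
have Fxx x : F x x = 0 by have := alt x x; lra.
rewrite !(linr, linl, Zr, Zl) !Fxx.
rewrite (alt e1 e0) (alt e2 e0) (alt e3 e0) (alt e2 e1) (alt e3 e1) (alt e3 e2).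
by ring.
Qed.

(** The quadratic form of [T] on the 2-vector u /\ v, whose Pluecker coordinates
are the [pij]. *)
Lemma curvature_like_square T (e0 e1 e2 e3 : V)
    (a0 a1 a2 a3 b0 b1 b2 b3 : R) : curvature_like T ->
  let u := a0 *: e0 + (a1 *: e1 + (a2 *: e2 + a3 *: e3)) in
  let v := b0 *: e0 + (b1 *: e1 + (b2 *: e2 + b3 *: e3)) in
  let p01 := a0 * b1 - a1 * b0 in let p12 := a1 * b2 - a2 * b1 in
  let p23 := a2 * b3 - a3 * b2 in let p03 := a0 * b3 - a3 * b0 in
  let p02 := a0 * b2 - a2 * b0 in let p13 := a1 * b3 - a3 * b1 in
  T u v u v =
    p01 ^+ 2 * T e0 e1 e0 e1 + p12 ^+ 2 * T e1 e2 e1 e2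
    + p23 ^+ 2 * T e2 e3 e2 e3 + p03 ^+ 2 * T e0 e3 e0 e3
    + p02 ^+ 2 * T e0 e2 e0 e2 + p13 ^+ 2 * T e1 e3 e1 e3
    + 2 * (p01 * p12 * T e0 e1 e1 e2 + p12 * p23 * T e1 e2 e2 e3
           + p23 * p03 * T e2 e3 e0 e3 + p03 * p01 * T e0 e3 e0 e1)
    + 2 * (p01 * p23 * T e0 e1 e2 e3 + p12 * p03 * T e1 e2 e0 e3
           + p02 * p13 * T e0 e2 e1 e3)
    + 2 * (p01 * p02 * T e0 e1 e0 e2 + p12 * p13 * T e1 e2 e1 e3
           + p23 * p02 * T e2 e3 e0 e2 + p03 * p13 * T e0 e3 e1 e3)
    + 2 * (p01 * p13 * T e0 e1 e1 e3 + p12 * p02 * T e1 e2 e0 e2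
           + p23 * p13 * T e2 e3 e1 e3 + p03 * p02 * T e0 e3 e0 e2).
Proof.
move=> hT u v; have [lin anti skew _] := hT.
have pair := curvature_like_pair hT.
rewrite (alternating_expansion e0 e1 e2 e3 a0 a1 a2 a3 b0 b1 b2 b3
  (F := fun x y => T x y u v)); last 2 first.
- by move=> a x y z; exact: curvature_like_linear2.
- by move=> x y; exact: anti.
have E x y : T x y u v = _ := alternating_expansion e0 e1 e2 e3 a0 a1 a2 a3
  b0 b1 b2 b3 (fun a z w => lin a x y z w) (skew x y).
rewrite !E.
rewrite (pair e1 e2 e0 e1) (pair e2 e3 e0 e1) (pair e2 e3 e1 e2).
rewrite (pair e0 e3 e1 e2) (pair e0 e3 e2 e3) (pair e0 e2 e0 e1).
rewrite (pair e0 e2 e1 e2) (pair e0 e2 e2 e3) (pair e0 e2 e0 e3).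
rewrite (pair e1 e3 e0 e1) (pair e1 e3 e1 e2) (pair e1 e3 e2 e3).
rewrite (pair e1 e3 e0 e3) (pair e1 e3 e0 e2) (pair e0 e1 e0 e3).
by cbv zeta; ring.
Qed.

(** [N] and [C] are g(u, u) and g(u, Su) when the basis is orthonormal, but the
identity itself does not involve a metric. *)
Lemma skew_circulant_curvature T (S : {linear V -> V}) (x : V)
    (a0 a1 a2 a3 : R) : curvature_like T ->
  (forall x y z w, T (S x) (S y) (S z) (S w) = T x y z w) ->
  S (S (S (S x))) = - x ->
  let e1 := S x in let e2 := S e1 in let e3 := S e2 in
  let u := a0 *: x + (a1 *: e1 + (a2 *: e2 + a3 *: e3)) in
  let N := a0 ^+ 2 + a1 ^+ 2 + a2 ^+ 2 + a3 ^+ 2 in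
  let C := a0 * a1 + a1 * a2 + a2 * a3 - a0 * a3 in
  2 * T u (S u) u (S u) + T u (S (S u)) u (S (S u)) =
    N ^+ 2 * T x e2 x e2 + 2 * (N ^+ 2 - C ^+ 2) * T x e1 x e1
    + C ^+ 2 * (4 * T x e1 e1 e2 + 6 * T x e1 e2 e3)
    + 4 * C * N * (T x e1 x e2 + T x e1 e1 e3).
Proof.
move=> hT inv S4 e1 e2 e3 u N C.
have [lin anti skew bianchi] := hT; have pair := curvature_like_pair hT.
have Se3 : S e3 = - x by [].
have T0 a b c : T a b c 0 = 0.
  by have := lin (-1) a b c 0 0; rewrite scaleN1r addNr => ->; ring.
have N4 a b c d : T a b c (- d) = T a b d c.
  by rewrite (skew a b d c) -[- d]addr0 -scaleN1r lin T0; ring.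
have N2 a b c d : T a (- b) c d = T b a c d by rewrite pair N4 pair.
have Su : S u = - a3 *: x + (a0 *: e1 + (a1 *: e2 + a2 *: e3)).
  rewrite /u !linearD !linearZ /= Se3 scalerN -scaleNr.
  by rewrite !addrA [LHS]addrC !addrA.
have SSu : S (S u) = - a2 *: x + (- a3 *: e1 + (a0 *: e2 + a1 *: e3)).
  rewrite Su !linearD !linearZ /= Se3 scalerN -scaleNr.
  by rewrite !addrA [LHS]addrC !addrA.
(* Except for [c2], which is the Bianchi identity, each equation moves a pair of
   planes one step along the permutation that S induces on planes; S e3 = - x
   is absorbed by swapping two arguments. *)
have d12 : T e1 e2 e1 e2 = T x e1 x e1 by exact: inv.
have d23 : T e2 e3 e2 e3 = T x e1 x e1 by rewrite -d12; exact: inv.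
have d03 : T x e3 x e3 = T x e1 x e1.
  by rewrite -d23 -(inv e2 e3) Se3 N2 N4.
have d13 : T e1 e3 e1 e3 = T x e2 x e2 by exact: inv.
have b1 : T e1 e2 e2 e3 = T x e1 e1 e2 by exact: inv.
have b2 : T e2 e3 x e3 = T x e1 e1 e2.
  by rewrite -b1 -(inv e1 e2) Se3 N4.
have b3 : T x e3 x e1 = T x e1 e1 e2.
  by rewrite -b2 -(inv e2 e3 x e3) Se3 N2 N4.
have c1 : T e1 e2 x e3 = T x e1 e2 e3.
  by rewrite -(inv x e1 e2 e3) Se3 N4.
have c2 : T x e2 e1 e3 = 2 * T x e1 e2 e3.
  have := bianchi x e1 e2 e3; rewrite c1 (anti e2 x) => E; lra.
have z1 : T e1 e2 e1 e3 = T x e1 x e2 by exact: inv.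
have z2 : T e2 e3 x e2 = T x e1 x e2.
  by rewrite -z1 -(inv e1 e2 e1) Se3 N4.
have z3 : T x e3 e1 e3 = T x e1 x e2.
  by rewrite -z2 -(inv e2 e3 x) Se3 N2.
have n1 : T e1 e2 x e2 = T x e1 e1 e3.
  by rewrite -(inv x e1 e1) Se3 N4.
have n2 : T e2 e3 e1 e3 = T x e1 e1 e3 by rewrite -n1; exact: inv.
have n3 : T x e3 x e2 = T x e1 e1 e3.
  by rewrite -n2 -(inv e2 e3 e1) Se3 N2 N4.
rewrite SSu Su !(curvature_like_square _ _ _ _ _ _ _ _ _ _ _ _ hT).
rewrite d12 d23 d03 d13 b1 b2 b3 c1 c2 z1 z2 z3 n1 n2 n3 /N /C.
by ring.
Qed.


End AlgebraicCurvature.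

(** * The curvature tensor at a point *)

Section CurvatureTensor.
Variables (R : realType) (n m : nat) (M : manifold R n).
Variables (g : riemannian_metric M) (nabla : vfield M -> vfield M -> vfield M).
Hypothesis hnabla : levi_civita g nabla.
Hypothesis hframe : forall p : M, exists (U : set M) (e : 'I_m -> vfield M),
  [/\ open_nbhs p U, forall i, vsmooth_on U (e i) & is_basis (fun i => e i p)].

(** Constant coefficients in a local frame suffice to extend a vector. *)
Lemma extensionP (p : M) (v : tangent p) : extension v p = v /\
  exists2 U, open_nbhs p U & vsmooth_on U (extension v).
Proof.
apply: (@xgetPex _ (fun q => 0 : tangent q)
  [set X : vfield M | X p = v /\ exists2 U, open_nbhs p U & vsmooth_on U X]).
have [U [e [nU se [_ span]]]] := hframe p; have [a va] := span v.
exists (fun q => \sum_i a i *: e i q); split; first exact: esym va.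
by exists U => //; exact: vsmooth_on_sum.
Qed.

Lemma common_domain (p : M) (x y z w : tangent p) : exists U, [/\ open U, U p,
  vsmooth_on U (extension x) /\ vsmooth_on U (extension y)
  & vsmooth_on U (extension z) /\ vsmooth_on U (extension w)].
Proof.
have [[_ [A nA sA]] [_ [B nB sB]]] := (extensionP x, extensionP y).
have [[_ [C nC sC]] [_ [D nD sD]]] := (extensionP z, extensionP w).
have [oU Up] := open_nbhsI (open_nbhsI nA nB) (open_nbhsI nC nD).
exists ((A `&` B) `&` (C `&` D)); split=> //; split.
- by apply: (vsmooth_on_sub _ sA) => q [[]].
- by apply: (vsmooth_on_sub _ sB) => q [[]].
- by apply: (vsmooth_on_sub _ sC) => q [_ []].
- by apply: (vsmooth_on_sub _ sD) => q [_ []].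
Qed.

(** The chosen extension of the last argument enters only through its value at
[p]; the other clauses hold for any smooth extensions. *)
Lemma curvature4_like (p : M) : curvature_like (@curvature4 R n M g nabla p).
Proof.
split=> [a x y z w w'|x y z w|x y z w|x y z w]; rewrite /curvature4 /curvature.
- by rewrite metricDr metricZr.
- have [U [oU Up [sx sy] [sz sw]]] := common_domain x y z w.
  rewrite (curvature_op_anti hnabla oU Up sx sy sz).
  by rewrite -scaleN1r metricZl mulN1r.
- have [U [oU Up [sx sy] [sz sw]]] := common_domain x y z w.
  have := curvature_op_skew hnabla oU Up sx sy sz sw.
  by rewrite (extensionP z).1 (extensionP w).1.
- have [U [oU Up [sx sy] [sz sw]]] := common_domain x y z w.
  rewrite -!metricDl (curvature_op_bianchi hnabla oU Up sx sy sz).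
  exact: metric0l.
Qed.

End CurvatureTensor.

(** * Metric consequences of the skew-circulant structure *)

Section SkewCirculantGeometry.
Variables (R : realType) (M : manifold R 4) (g : riemannian_metric M).
Variable S : forall q : M, {linear tangent q -> tangent q}.
Hypothesis hS : skew_circulant_structure g S.

Lemma skew_circulant_pow4 (p : M) (v : tangent p) :
  S p (S p (S p (S p v))) = - v.
Proof.
have [U [e [[_ Up] [_ /(_ p Up)[[_ span] Se _]]]]] := structure_frame hS p.
have Sord (i j : 'I_4) : j = i.+1 :> nat -> S p (e i p) = e j p.
  move=> ij; have i3 : (i == 3 :> nat) = false.
    by rewrite ltn_eqF// -ltnS -ij.
  rewrite Se (bigD1 j)//= big1 ?addr0 => [|k kj]; rewrite !mxE i3 -ij subr0.
    by rewrite eqxx scale1r.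
  rewrite (_ : (j == k :> nat) = false) ?scale0r//.
  by apply/negbTE; rewrite eq_sym.
have Se3 : S p (e 3 p) = - e 0 p.
  rewrite Se (bigD1 0)//= big1 ?addr0 => [|k k0]; rewrite !mxE /=.
    by rewrite sub0r scaleN1r.
  rewrite (_ : (k == 0 :> nat) = false) ?subr0; last exact/negbTE.
  by rewrite gtn_eqF ?scale0r//; exact: ltn_ord k.
have [Se0 Se1 Se2] := And3 (Sord 0 1 erefl) (Sord 1 2 erefl) (Sord 2 3 erefl).
have S4 i : S p (S p (S p (S p (e i p)))) = - e i p.
  case: i => -[|[|[|[|//]]]] lti.
  - rewrite (_ : Ordinal lti = 0); last exact: val_inj.
    by rewrite Se0 Se1 Se2 Se3.
  - rewrite (_ : Ordinal lti = 1); last exact: val_inj.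
    by rewrite Se1 Se2 Se3 linearN Se0.
  - rewrite (_ : Ordinal lti = 2); last exact: val_inj.
    by rewrite Se2 Se3 linearN Se0 linearN Se1.
  - rewrite (_ : Ordinal lti = 3); last exact: val_inj.
    by rewrite Se3 linearN Se0 linearN Se1 linearN Se2.
have [a ->] := span v.
rewrite !linear_sum; apply: eq_bigr => i _.
by rewrite !linearZ /= S4 scalerN.
Qed.

Lemma metric_S2_orthogonal (p : M) (v : tangent p) :
  g p v (S p (S p v)) = 0.
Proof.
have iso := structure_isometry hS.
have E : g p v (S p (S p v)) = - g p v (S p (S p v)).
  rewrite -[LHS]iso -[LHS]iso skew_circulant_pow4 -scaleN1r metricZr mulN1r.
  by rewrite Defs.metric_sym.
by lra.
Qed.

(** Strict Cauchy-Schwarz for [u] and [Su], from the positive norm of the vector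
N Su - C u, where N = g(u, u) and C = g(u, Su). *)
Lemma metric_S_lt (p : M) (u : tangent p) : induces_S_basis S u ->
  0 < g p u u /\ g p u (S p u) ^+ 2 < g p u u ^+ 2.
Proof.
move=> [indep _]; have iso := structure_isometry hS.
set N := g p u u; set C := g p u (S p u).
have family a b : a *: S p u + b *: u = 0 -> a = 0 /\ b = 0.
  move=> ab; pose c (i : 'I_4) := if i == 2 then a else if i == 3 then b else 0.
  have := indep c; rewrite !big_ord_recl big_ord0 /c /= !scale0r !add0r addr0.
  by move=> /(_ ab) c0; split; [exact: (c0 2) | exact: (c0 3)].
have N0 : 0 < N.
  apply: metric_pos; apply/eqP => u0.
  have [] := family 0 1; first by rewrite scale0r u0 scaler0 addr0.
  by move=> _ /eqP; rewrite oner_eq0.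
split=> //; pose w := N *: S p u + (- C) *: u.
have : 0 < g p w w.
  apply: metric_pos; apply/eqP => /family[N00 _].
  by move: N0; rewrite N00 ltxx.
have -> : g p w w = N * (N ^+ 2 - C ^+ 2).
  rewrite /w !(metricDl, metricDr, metricZl, metricZr) iso.
  by rewrite (Defs.metric_sym g (S p u) u) -/N -/C; ring.
by rewrite pmulr_rgt0// subr_gt0.
Qed.


End SkewCirculantGeometry.

(** * The identity for sectional curvatures *)

Theorem theorem4p2 (R : realType) (M : manifold R 4) (g : riemannian_metric M)
    (S : forall q : M, {linear tangent q -> tangent q})
    (nabla : vfield M -> vfield M -> vfield M)
    (hS : skew_circulant_structure g S)
    (hnabla : levi_civita g nabla)
    (hR : forall (q : M) (x y z u : tangent q),
      curvature4 g nabla (S q x) (S q y) (S q z) (S q u)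
        = curvature4 g nabla x y z u)
    (p : M) (x u : tangent p)
    (hx : induces_S_basis S x) (hu : induces_S_basis S u)
    (hxo : orthonormal_family g (S_family S x)) :
  let k := @sectional R 4 M g nabla p in
  let Rm := @curvature4 R 4 M g nabla p in
  let S1 := S p in
  let S2 := fun v => S p (S p v) in
  let S3 := fun v => S p (S p (S p v)) in
  let phi := angle g u (S1 u) in
  2 * (1 - cos phi ^+ 2) * k u (S1 u) + k u (S2 u)
  = k x (S2 x) + 2 * (1 - cos phi ^+ 2) * k x (S1 x)
    + cos phi ^+ 2 * (4 * Rm x (S1 x) (S1 x) (S2 x)
                      + 6 * Rm x (S1 x) (S2 x) (S3 x))
    + 4 * cos phi * (Rm x (S1 x) x (S2 x) + Rm x (S1 x) (S1 x) (S3 x)).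
Proof.
move=> k Rm S1 S2 S3 phi.
have Rlike : curvature_like Rm.
  apply: (curvature4_like (m := 4) hnabla) => q.
  have [U [e [nU [se frame]]]] := structure_frame hS q.
  by exists U, e; split=> //; have [] := frame q nU.2.
have S4 := skew_circulant_pow4 hS; have iso := structure_isometry hS.
have [Npos CN] := metric_S_lt hS hu.
have [a ua] := hx.2 u.
have uE : u = a 3 *: x + (a 2 *: S1 x + (a 1 *: S2 x + a 0 *: S3 x)).
  rewrite ua !big_ord_recl big_ord0 addr0.
  rewrite (_ : lift ord0 (lift ord0 (lift ord0 ord0)) = 3 :> 'I_4);
    last exact: val_inj.
  rewrite (_ : lift ord0 (lift ord0 ord0) = 2 :> 'I_4);
    last exact: val_inj.
  rewrite (_ : lift ord0 ord0 = 1 :> 'I_4);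
    last exact: val_inj.
  by rewrite /S_family /= addrC (addrC (_ *: S p (S p x))) (addrC (_ *: S p x))
    -!addrA.
(* The family lists S^3 x first, so index 3 - k stands for S^k x. *)
have gram (i j : 'I_4) :
    g p (iter (3 - i : nat) (S p) x) (iter (3 - j : nat) (S p) x) =
    (i == j)%:R by exact: hxo.
have g00 : g p x x = 1 := gram 3 3.
have g01 : g p x (S1 x) = 0 := gram 3 2.
have g02 : g p x (S2 x) = 0 := gram 3 1.
have g03 : g p x (S3 x) = 0 := gram 3 0.
have iso1 y z : g p (S1 y) (S1 z) = g p y z by exact: iso.
have g11 : g p (S1 x) (S1 x) = 1 := gram 2 2.
have g12 : g p (S1 x) (S2 x) = 0 := gram 2 1.
have g13 : g p (S1 x) (S3 x) = 0 := gram 2 0.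
have g22 : g p (S2 x) (S2 x) = 1 := gram 1 1.
have g23 : g p (S2 x) (S3 x) = 0 := gram 1 0.
have g33 : g p (S3 x) (S3 x) = 1 := gram 0 0.
have gE := (g00, g01, g02, g03, (g11, g12, g13, g22), (g23, g33),
  (Defs.metric_sym g (S1 x) x, Defs.metric_sym g (S2 x) x,
   Defs.metric_sym g (S3 x) x, Defs.metric_sym g (S2 x) (S1 x),
   Defs.metric_sym g (S3 x) (S1 x), Defs.metric_sym g (S3 x) (S2 x))).
set N := g p u u in Npos CN; set C := g p u (S p u) in CN.
have NE : N = a 3 ^+ 2 + a 2 ^+ 2 + a 1 ^+ 2 + a 0 ^+ 2.
  rewrite /N uE !(metricDl, metricDr, metricZl, metricZr) !gE.
  by ring.
have SuE : S p u = a 3 *: S1 x + (a 2 *: S2 x + (a 1 *: S3 x + - a 0 *: x)).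
  by rewrite {1}uE !linearD !linearZ /= S4 scalerN scaleNr.
have CE : C = a 3 * a 2 + a 2 * a 1 + a 1 * a 0 - a 3 * a 0.
  rewrite /C SuE {1}uE !(metricDl, metricDr, metricZl, metricZr) !gE.
  by ring.
have main : 2 * Rm u (S1 u) u (S1 u) + Rm u (S2 u) u (S2 u) =
    N ^+ 2 * Rm x (S2 x) x (S2 x)
    + 2 * (N ^+ 2 - C ^+ 2) * Rm x (S1 x) x (S1 x)
    + C ^+ 2 * (4 * Rm x (S1 x) (S1 x) (S2 x) + 6 * Rm x (S1 x) (S2 x) (S3 x))
    + 4 * C * N * (Rm x (S1 x) x (S2 x) + Rm x (S1 x) (S1 x) (S3 x)).
  have := skew_circulant_curvature (a 3) (a 2) (a 1) (a 0) Rlike (hR p)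
    (S4 p x).
  by cbv zeta; rewrite -uE -NE -CE.
have cosE : cos phi = C / N.
  rewrite /phi /angle iso1 -/N -/C -expr2 sqr_sqrtr ?ltW// acosK//.
  have : `|C| < N.
    rewrite -(@ltr_pXn2r _ 2) ?nnegrE ?normr_ge0 ?(ltW Npos)//.
    by rewrite real_normK ?num_real.
  move=> /ltW; rewrite -[leRHS]mul1r -ler_pdivrMr// => CN1.
  by rewrite in_itv /= -ler_norml normrM normfV (gtr0_norm Npos).
rewrite /k /sectional -/Rm g00 g11 g01 g22 g02 iso1 !iso -/N -/C.
rewrite (metric_S2_orthogonal hS) cosE.
set A := Rm u _ _ _ in main *; set B := Rm u (S2 u) _ _ in main *.
have N0 : N != 0 by rewrite gt_eqF.
have NC0 : N ^+ 2 - C ^+ 2 != 0 by rewrite subr_eq0 gt_eqF.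
transitivity ((2 * A + B) / N ^+ 2).
  by field; rewrite N0 NC0.
rewrite main.
by field; rewrite N0.
Qed.
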